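(* Let $\mathcal{E}\colon I\to\mathbb{R}$ be the error-sum function of Pierce expansions on $I=[0,1]$, and let $G(I)=\{(x,\mathcal{E}(x)) : x\in I\}\subseteq\mathbb{R}^2$ be its graph. Then the Hausdorff dimension of the graph is one: $\dim_H G(I)=1$.
   Context: Let $I=[0,1]$ and $\mathbb{N}_\infty=\mathbb{N}\cup\{\infty\}$ where $\mathbb{N}=\{1,2,3,\dots\}$, with the conventions $\infty+c=\infty$ and $c/\infty=0$ for $c\in\mathbb{R}$; a product of elements of $\mathbb{N}_\infty$ with a factor $\infty$ equals $\infty$. Define $d_1\colon I\to\mathbb{N}_\infty$ and $T\colon I\to I$ by $d_1(x)=\lfloor 1/x\rfloor$, $T(x)=1-d_1(x)\,x$ for $x\neq 0$, and $d_1(0)=\infty$, $T(0)=0$. For $n\in\mathbb{N}$ let $d_n(x)=d_1(T^{n-1}x)$ (the Pierce expansion digits of $x$), and let $$s_n(x)=\sum_{k=1}^n\frac{(-1)^{k+1}}{d_1(x)\cdots d_k(x)}.$$ The error-sum function of Pierce expansions is $\mathcal{E}\colon I\to\mathbb{R}$, $\mathcal{E}(x)=\sum_{n=1}^\infty (x-s_n(x))$ (the series converges absolutely and uniformly on $I$). $\dim_H$ denotes the Hausdorff dimension of subsets of $\mathbb{R}^2$ with the Euclidean metric. *)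

(* Defs.v *)
From HB Require Import structures.
From mathcomp Require Import all_boot all_order all_algebra.
From mathcomp Require Import all_classical all_reals all_analysis.

Set Implicit Arguments.
Unset Strict Implicit.
Unset Printing Implicit Defensive.

Import Order.TTheory GRing.Theory Num.Theory.
Import numFieldNormedType.Exports.

Local Open Scope classical_set_scope.
Local Open Scope ring_scope.

Section pierce.
Context {R : realType}.
Implicit Types (x : R) (n : nat).

(* N_oo is embedded in \bar R: there a product of positive factors one of which
   is +oo equals +oo, and c%:E / +oo = 0 for c real.  All functions are total
   on R; only their values on [0, 1] are meaningful. *)
Definition pierce_d1 x : \bar R :=
  if x == 0 then +oo%E else (Num.floor x^-1)%:~R%:E.

Definition pierce_T x : R := if x == 0 then 0 else 1 - fine (pierce_d1 x) * x.

(* The digits are indexed from n = 1; the value at n = 0 is junk. *)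
Definition pierce_digit n x : \bar R := pierce_d1 (iter n.-1 pierce_T x).

Definition pierce_sum n x : R :=
  \sum_(1 <= k < n.+1)
    fine (((-1) ^+ k.+1)%:E / \big[*%E/1%E]_(1 <= j < k.+1) pierce_digit j x)%E.

Definition pierce_error_sum x : R :=
  limn (fun N => \sum_(1 <= n < N.+1) (x - pierce_sum n x)).

Definition pierce_error_sum_graph : set (R * R) :=
  [set (x, pierce_error_sum x) | x in `[0, 1]].

End pierce.

Section hausdorff_dimension.
Context {R : realType}.
Implicit Types (p q : R * R) (A U : set (R * R)) (s delta : R).
Local Open Scope ereal_scope.

(* The library norm on R * R is the sup norm. *)
Definition eucl_dist p q : R :=
  Num.sqrt ((p.1 - q.1) ^+ 2 + (p.2 - q.2) ^+ 2)%R.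

(* Adding 0 to the set of distances only gives diam set0 = 0. *)
Definition eucl_diam U : \bar R :=
  ereal_sup (0 |` [set (eucl_dist pq.1 pq.2)%:E | pq in U `*` U]).

(* diam(U)^s; in exponent 0 it is 1 on nonempty sets (0 `^ 0 = 1), 0 on set0. *)
Definition hausdorff_gauge s U : \bar R :=
  if U == set0 then 0 else eucl_diam U `^ s.

Definition hausdorff_premeasure s delta A : \bar R :=
  ereal_inf [set \sum_(i <oo) hausdorff_gauge s (F i) |
    F in [set F : (set (R * R))^nat |
      A `<=` \bigcup_i F i /\ forall i, eucl_diam (F i) <= delta%:E]].

Definition hausdorff_measure s A : \bar R :=
  ereal_sup [set hausdorff_premeasure s delta A | delta in [set d : R | (0 < d)%R]].

Definition hausdorff_dim A : \bar R :=
  ereal_inf [set s%:E | s in [set s : R | (0 <= s)%R /\ hausdorff_measure s A = 0]].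

End hausdorff_dimension.

(* Main.v *)
Require Import Defs.
From mathcomp Require Import all_boot all_order all_algebra.
From mathcomp Require Import all_classical all_reals all_analysis.
From mathcomp Require Import ring lra.

(** Write E for the error-sum function, T for the Pierce map, d for the first
    digit of x and y = T x.  Every remainder x - s_n(x) of x is -1/d times the
    preceding remainder of y, and x = (1 - y)/d, so that
      E(x) = - (y + E(y)) / d        ([pierce_error_sumE]).
    Remainders decay geometrically, which gives |E(x)| <= 2x
    ([pierce_error_sum_le]).

    Upper bound.  The functional equation says that the part of the graph where
    the first digit is d is an affine copy of the part above [0, 1/(d+1)): the
    linear part is -1/d times the shear (u, v) |-> (u, u + v).  To deal with
    similarities only, the shear is moved into the set: the sheared graph
    Gamma_k(m) is the graph of kx + E(x) over [0, 1/m], and it is covered by the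
    origin and by copies of Gamma_{k+1}(d+1) with ratio 1/d, for d >= m
    ([sheared_graph_cover]).  Let s > 1 and let h be the s-dimensional
    Hausdorff content, the outer measure in which covers are not required to be
    fine.  From |E(x)| <= 2x one gets h(Gamma_k(m)) <= ((2k+5)/m)^s.  Since
      sum_{d >= m} (1/(d(d+1)))^s <= theta m^(-s),  theta = 2^(1-s) < 1,
    each use of the covering gains a factor theta and costs one more shear, so
    h(Gamma_k(m)) <= theta^n ((2(k+n)+5)/m)^s for all n
    ([content_sheared_graph_iter]).  The exponential beats the power: the graph,
    which is Gamma_0(1), has content 0, and a set of content 0 has Hausdorff
    measure 0 ([content0_measure0]), so the dimension is at most s.

    Lower bound.  The first projection maps the graph onto [0, 1] and does not
    increase distances.  If s <= 1, a cover by sets of diameter at most 1 with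
    small sum of diam^s would project to a cover of [0, 1] of small total
    length ([hausdorff_measure_proj_neq0]). *)

Set Implicit Arguments.
Unset Strict Implicit.
Unset Printing Implicit Defensive.

Import Order.TTheory GRing.Theory Num.Theory.
Import numFieldNormedType.Exports.

Local Open Scope classical_set_scope.
Local Open Scope ring_scope.

(** * The functional equation of the error-sum function *)

Section pierce_recursion.
Context {R : realType}.
Implicit Types x : R.

Lemma pierce_d1P x : 0 < x <= 1 ->
  exists d : nat, [/\ (0 < d)%N, pierce_d1 x = d%:R%:E
                    & d.+1%:R^-1 < x <= d%:R^-1].
Proof.
move=> /andP[x0 x1]; have x0' : x != 0 by rewrite gt_eqF.
have f1 : (1 <= Num.floor x^-1) by rewrite floor_ge_int invf_ge1.
exists `|Num.floor x^-1|%N; have /andP[fl fu] := floor_itv x^-1.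
have fE : `|Num.floor x^-1|%N%:R = (Num.floor x^-1)%:~R :> R.
  by rewrite natr_absz ger0_norm// (le_trans _ f1).
have f0 : 0 < (Num.floor x^-1)%:~R :> R by rewrite ltr0z (lt_le_trans _ f1).
split.
- by rewrite absz_gt0 gt_eqF// (lt_le_trans _ f1).
- by rewrite /pierce_d1 (negbTE x0') fE.
- rewrite -natr1 fE -[ltRHS]invrK -[in leLHS](invrK x).
  rewrite ltf_pV2 ?posrE ?invr_gt0// ?addr_gt0//.
  rewrite lef_pV2 ?posrE ?invr_gt0// fl andbT.
  by move: fu; rewrite intrD.
Qed.

Lemma pierce_TE x (d : nat) : x != 0 -> pierce_d1 x = d%:R%:E ->
  pierce_T x = 1 - d%:R * x.
Proof. by move=> x0 dx; rewrite /pierce_T (negbTE x0) dx. Qed.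

Lemma pierce_T_itv x (d : nat) :
    (0 < d)%N -> d.+1%:R^-1 < x <= d%:R^-1 -> pierce_d1 x = d%:R%:E ->
  0 <= pierce_T x < d.+1%:R^-1.
Proof.
move=> d0 /andP[xl xu] dx.
have dr0 : 0 < d%:R :> R by rewrite ltr0n.
have x0 : 0 < x by apply: lt_trans xl; rewrite invr_gt0 ltr0n.
rewrite (pierce_TE _ dx) ?gt_eqF//; apply/andP; split.
  by rewrite subr_ge0 mulrC -ler_pdivlMr// div1r.
rewrite ltrBlDr -ltrBlDl (_ : 1 - _ = d%:R * d.+1%:R^-1) ?ltr_pM2l//.
by rewrite -natr1; field; rewrite natr1 pnatr_eq0.
Qed.

Lemma pierce_digitS n x : (0 < n)%N ->
  pierce_digit n.+1 x = pierce_digit n (pierce_T x).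
Proof. by case: n => // n _; rewrite /pierce_digit -iterSr. Qed.

Lemma pierce_prod_digitS n x :
  (\big[*%E/1%E]_(1 <= j < n.+2) pierce_digit j x =
   pierce_d1 x * \big[*%E/1%E]_(1 <= j < n.+1) pierce_digit j (pierce_T x))%E.
Proof.
rewrite big_ltn// big_add1; congr (_ * _)%E.
by apply: eq_big_nat => j /andP[j0 _]; rewrite pierce_digitS.
Qed.

(** When P is 0, +oo or -oo both quotients are 0 or infinite, and [fine] sends
    them to 0; this covers the digits +oo of finite expansions. *)
Lemma fine_div_posM (a d : R) (P : \bar R) : 0 < d ->
  fine (a%:E / (d%:E * P)) = fine (a%:E / P) / d.
Proof.
move=> d0; have dn0 : d != 0 by rewrite gt_eqF.
have fy : fine (a%:E * +oo) = 0 by rewrite /mule/=; case: ifP => // _; case: ifP.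
have fNy : fine (a%:E * -oo) = 0 by rewrite /mule/=; case: ifP => // _; case: ifP.
case: P => [r| |].
- rewrite -EFinM !inver mulf_eq0 (negbTE dn0)/=; case: ifPn => r0.
    by rewrite fy mul0r.
  by rewrite /= invfM mulrCA mulrC.
- by rewrite gt0_muley ?lte_fin// invey mule0 /= mul0r.
- by rewrite gt0_muleNy ?lte_fin// inveNy fNy mul0r.
Qed.


Lemma pierce_sumS n x (d : nat) : (0 < d)%N -> pierce_d1 x = d%:R%:E ->
  pierce_sum n.+1 x = (1 - pierce_sum n (pierce_T x)) / d%:R.
Proof.
move=> d0 dx; have dr0 : 0 < d%:R :> R by rewrite ltr0n.
rewrite /pierce_sum big_ltn// mulrBl mul1r; congr (_ + _).
  rewrite big_nat1 /pierce_digit/= dx sqrrN expr1n mul1e.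
  by rewrite inver gt_eqF.
rewrite big_add1/= mulr_suml -sumrN; apply: eq_big_nat => k /andP[k0 _].
rewrite pierce_prod_digitS dx fine_div_posM// exprS mulN1r.
by rewrite EFinN mulNe fineN mulNr.
Qed.

Definition pierce_rem n x : R := x - pierce_sum n x.

Lemma pierce_rem0 x : pierce_rem 0 x = x.
Proof. by rewrite /pierce_rem /pierce_sum big_geq// subr0. Qed.

Lemma pierce_remS n x (d : nat) : x != 0 -> (0 < d)%N ->
    pierce_d1 x = d%:R%:E ->
  pierce_rem n.+1 x = - (pierce_rem n (pierce_T x) / d%:R).
Proof.
move=> x0 d0 dx; have dn0 : d%:R != 0 :> R by rewrite pnatr_eq0 -lt0n.
rewrite /pierce_rem (pierce_sumS _ d0 dx) {2}(pierce_TE x0 dx).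
by field.
Qed.

Lemma pierce_rem_at0 n : pierce_rem n (0 : R) = 0.
Proof.
have T0 k : iter k pierce_T (0 : R) = 0.
  by elim: k => //= k ->; rewrite /pierce_T eqxx.
rewrite /pierce_rem /pierce_sum sub0r big_nat big1 ?oppr0// => k /andP[k0 _].
have -> : (\big[*%E/1]_(1 <= j < k.+1) pierce_digit j (0 : R) = +oo)%E.
  case: k k0 => // k _; elim: k => [|k IH].
    by rewrite big_nat1 /pierce_digit/= /pierce_d1 eqxx.
  by rewrite big_nat_recr// IH /pierce_digit T0 /pierce_d1 eqxx.
by rewrite invey mule0.
Qed.

(** On [0, 1/2] the first digit is at least 2 and T x <= x, so that each step
    of [pierce_remS] halves the bound and stays in [0, 1/2]. *)
Lemma pierce_rem_le_half n x : 0 <= x <= 2^-1 ->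
  `|pierce_rem n x| <= 2^-1 ^+ n * x.
Proof.
elim: n x => [|n IH] x /andP[x0 x2].
  by rewrite pierce_rem0 expr0 mul1r ger0_norm.
move: x0; rewrite le_eqVlt => /predU1P[<-|x0].
  by rewrite pierce_rem_at0 normr0 mulr0.
have [|d [d0 dx xd]] := @pierce_d1P x; first by rewrite x0; lra.
have /andP[T0 Td] := pierce_T_itv d0 xd dx.
have Tx : pierce_T x <= x by case/andP: xd => xd _; apply/ltW/(lt_trans Td).
have d2 : 2 <= d%:R :> R.
  rewrite ler_nat ltnNge; apply/negP => d1; case/andP: xd => + _; apply/negP.
  rewrite -leNgt (le_trans x2)// lef_pV2 ?posrE// ler_nat.
  by move: d1; rewrite -ltnS.
rewrite (pierce_remS _ _ d0 dx) ?gt_eqF// normrN normrM normfV normr_nat.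
rewrite ler_pdivrMr ?ltr0n//; apply: le_trans (IH _ _) _.
  by rewrite T0 (le_trans Tx).
rewrite exprS -!mulrA [leRHS]mulrCA ler_pM2l ?exprn_gt0// mulrCA.
by apply: (le_trans Tx); rewrite ler_peMr ?(ltW x0)//; lra.
Qed.

(** If x > 1/2 the first digit is 1 and nothing is gained by the first step, but
    it leads to T x = 1 - x < 1/2, where [pierce_rem_le_half] applies: hence the
    loss of one factor 1/2. *)
Lemma pierce_rem_le n x : 0 <= x <= 1 -> `|pierce_rem n.+1 x| <= 2^-1 ^+ n * x.
Proof.
move=> /andP[x0 x1]; have [x2|x2] := leP x 2^-1.
  apply: le_trans (pierce_rem_le_half n.+1 _) _; first by rewrite x0.
  by rewrite ler_wpM2r// ler_wiXn2l//; lra.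
have xp : 0 < x by lra.
have [|d [d0 dx xd]] := @pierce_d1P x; first by rewrite xp.
have d1 : d = 1%N.
  apply/eqP; rewrite eqn_leq d0 andbT leqNgt; apply/negP => d1.
  case/andP: xd => _; apply/negP; rewrite -ltNge (le_lt_trans _ x2)//.
  by rewrite lef_pV2 ?posrE ?ltr0n// ler_nat.
have TE := pierce_TE (lt0r_neq0 xp) dx; rewrite d1 mul1r in TE.
rewrite (pierce_remS _ _ d0 dx) ?gt_eqF// normrN d1 divr1 TE.
apply: le_trans (pierce_rem_le_half _ _) _; first by apply/andP; split; lra.
by rewrite ler_pM2l ?exprn_gt0//; lra.
Qed.

Lemma pierce_error_sum_series x :
  pierce_error_sum x = limn (series (fun n => pierce_rem n.+1 x)).
Proof.
rewrite /pierce_error_sum; congr (lim (_ @ \oo)); apply/funext => N.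
by rewrite /series/= big_add1.
Qed.

Lemma cvg_normed_pierce_rem x : 0 <= x <= 1 ->
  cvgn [normed series (fun n => pierce_rem n.+1 x)].
Proof.
move=> x01; apply: (@series_le_cvg _ _ (geometric x 2^-1)).
- by move=> n; exact: normr_ge0.
- by move=> n; case/andP: x01 => x0 _; rewrite /geometric/= mulr_ge0// exprn_ge0.
- by move=> n; rewrite /geometric/= mulrC; exact: pierce_rem_le.
- by apply: is_cvg_geometric_series; rewrite gtr0_norm; lra.
Qed.

Lemma cvg_pierce_error_sum x : 0 <= x <= 1 ->
  series (fun n => pierce_rem n.+1 x) @ \oo --> pierce_error_sum x.
Proof.
move=> x01; rewrite pierce_error_sum_series; apply: normed_cvg.
exact: cvg_normed_pierce_rem.
Qed.

Lemma pierce_error_sum_le x : 0 <= x <= 1 -> `|pierce_error_sum x| <= 2 * x.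
Proof.
move=> x01; rewrite pierce_error_sum_series.
apply: le_trans (lim_series_norm (cvg_normed_pierce_rem x01)) _.
have half1 : `|2^-1| < 1 :> R by rewrite gtr0_norm; lra.
have -> : 2 * x = limn (series (geometric x 2^-1)).
  by rewrite (cvg_lim _ (cvg_geometric_series half1))//; field.
apply: lim_series_le; first exact: cvg_normed_pierce_rem.
  exact: is_cvg_geometric_series.
by move=> n; rewrite /geometric/= mulrC; exact: pierce_rem_le.
Qed.

(** The remainder of index 1 of x is -T x / d and, for n >= 1, the remainder of
    index n+1 of x is -1/d times that of index n of T x.  The limit of the
    partial sums passes through the recursion. *)
Lemma pierce_error_sumE x (d : nat) : 0 < x <= 1 -> (0 < d)%N ->
    d.+1%:R^-1 < x <= d%:R^-1 -> pierce_d1 x = d%:R%:E ->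
  pierce_error_sum x = - ((pierce_T x + pierce_error_sum (pierce_T x)) / d%:R).
Proof.
move=> /andP[x0 x1] d0 xd dx.
have /andP[T0 Td] := pierce_T_itv d0 xd dx.
have T1 : pierce_T x <= 1 by rewrite (le_trans (ltW Td))// invf_le1 ?ltr0n// ler1n.
have x01 : 0 <= x <= 1 by rewrite ltW.
have T01 : 0 <= pierce_T x <= 1 by rewrite T0.
have := cvg_pierce_error_sum x01; rewrite -cvg_shiftS => Ex.
apply/esym; apply: cvg_unique Ex => //=.
rewrite (_ : (fun n => _) = fun n =>
    - ((pierce_T x + series (fun n => pierce_rem n.+1 (pierce_T x)) n) / d%:R)).
  apply: cvgN; apply: cvgMl; apply: cvgD; [exact: cvg_cst|].
  exact: cvg_pierce_error_sum.
apply/funext => n; rewrite /series/= big_nat_recl//= mulrDl opprD.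
rewrite (pierce_remS _ _ d0 dx) ?gt_eqF// pierce_rem0; congr (_ + _).
rewrite mulr_suml -sumrN; apply: eq_bigr => i _.
by rewrite (pierce_remS _ _ d0 dx) ?gt_eqF.
Qed.

End pierce_recursion.

(** * Hausdorff content *)

Section hausdorff_content.
Context {R : realType}.
Implicit Types (p q : R * R) (A B U : set (R * R)) (s : R).
Local Open Scope ereal_scope.

Lemma eucl_diam_ge0 U : 0 <= eucl_diam U.
Proof. by apply: ereal_sup_ubound; left. Qed.

Lemma eucl_dist_le_diam U p q : U p -> U q -> (eucl_dist p q)%:E <= eucl_diam U.
Proof. by move=> Up Uq; apply: ereal_sup_ubound; right; exists (p, q). Qed.

Lemma eucl_diam_le U (M : \bar R) : 0 <= M ->
  (forall p q, U p -> U q -> (eucl_dist p q)%:E <= M) -> eucl_diam U <= M.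
Proof.
by move=> M0 UM; apply: ge_ereal_sup => _ [->//|[[p q] [Up Uq] <-]]; exact: UM.
Qed.

Lemma eucl_dist_fst p q : (`|p.1 - q.1| <= eucl_dist p q)%R.
Proof. by rewrite -sqrtr_sqr ler_wsqrtr// lerDl sqr_ge0. Qed.

Lemma eucl_dist_le_sum p q : (eucl_dist p q <= `|p.1 - q.1| + `|p.2 - q.2|)%R.
Proof.
rewrite /eucl_dist -[leRHS]ger0_norm ?addr_ge0// -[leRHS]sqrtr_sqr.
rewrite ler_wsqrtr//.
rewrite [leRHS]sqrrD -!normrX !(ger0_norm (sqr_ge0 _)) addrAC lerDl.
by rewrite mulrn_wge0// mulr_ge0.
Qed.

Lemma hausdorff_gauge_ge0 s U : 0 <= hausdorff_gauge s U.
Proof. by rewrite /hausdorff_gauge; case: ifP => // _; exact: poweR_ge0. Qed.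

Lemma hausdorff_gauge0 s : hausdorff_gauge s set0 = 0 :> \bar R.
Proof. by rewrite /hausdorff_gauge eqxx. Qed.

Lemma ge0_le_poweR s (x y : \bar R) : (0 <= s)%R -> 0 <= x -> x <= y ->
  x `^ s <= y `^ s.
Proof.
move=> s0 x0 xy; apply: gt0_ler_poweR => //; rewrite in_itv/= leey andbT//.
exact: le_trans xy.
Qed.

Lemma hausdorff_gauge_le s U (M : \bar R) : (0 <= s)%R -> eucl_diam U <= M ->
  hausdorff_gauge s U <= M `^ s.
Proof.
move=> s0 UM; rewrite /hausdorff_gauge; case: ifP => _; first exact: poweR_ge0.
by apply: ge0_le_poweR => //; exact: eucl_diam_ge0.
Qed.

(* [mu_ext] covers by measurable sets: over the sigma-algebra of all subsets it
   covers by arbitrary ones. *)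
Let discrete_plane := g_sigma_algebraType [set: set (R * R)].

(** The Hausdorff premeasure without the bound on the diameters of the covering
    sets.  Without the bound it is the outer measure generated by the gauge, hence
    countably subadditive, and images of covers under Lipschitz maps are again
    admissible ([content_lipschitz]). *)
Definition hausdorff_content s : set (R * R) -> \bar R :=
  @mu_ext _ discrete_plane R (hausdorff_gauge s).

Lemma content_le_cover s A (F : (set (R * R))^nat) : A `<=` \bigcup_i F i ->
  hausdorff_content s A <= \sum_(i <oo) hausdorff_gauge s (F i).
Proof.
by move=> AF; apply: ereal_inf_lbound; exists F => //; split => // i;
  exact: sub_sigma_algebra.
Qed.

Lemma content_ge0 s A : 0 <= hausdorff_content s A.
Proof. exact: (@mu_ext_ge0 _ discrete_plane _ _ (@hausdorff_gauge_ge0 s)). Qed.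

Lemma le_content s A B : A `<=` B -> hausdorff_content s A <= hausdorff_content s B.
Proof. exact: (@le_mu_ext _ discrete_plane). Qed.

Lemma content_bigcup s A (F : (set (R * R))^nat) : A `<=` \bigcup_i F i ->
  hausdorff_content s A <= \sum_(i <oo) hausdorff_content s (F i).
Proof.
move=> AF; apply: (le_trans (le_content s AF)).
exact: (@mu_ext_sigma_subadditive _ discrete_plane _ _ (@hausdorff_gauge_ge0 s)).
Qed.

Lemma content_le_gauge s A : hausdorff_content s A <= hausdorff_gauge s A.
Proof.
apply: le_trans (@content_le_cover s A (fun n => if n is 0%N then A else set0) _) _.
  by move=> x Ax; exists 0%N.
rewrite nneseries_recl//; last by move=> *; exact: hausdorff_gauge_ge0.
rewrite eseries0 ?adde0// => -[|i]// _ _; exact: hausdorff_gauge0.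
Qed.

Lemma content_lipschitz s r (f : R * R -> R * R) A : (0 <= s)%R -> (0 < r)%R ->
  (forall p q, eucl_dist (f p) (f q) <= r * eucl_dist p q)%R ->
  hausdorff_content s (f @` A) <= (r `^ s)%:E * hausdorff_content s A.
Proof.
move=> s0 r0 fr; have rs0 : (0 < r `^ s)%R by exact: powR_gt0.
rewrite -lee_pdivrMl//; apply: le_ereal_inf_tmp => _ [F [_ AF] <-].
rewrite lee_pdivrMl// -nneseriesZl; last by move=> *; exact: hausdorff_gauge_ge0.
apply: le_trans (@content_le_cover s _ (fun i => f @` F i) _) _.
  by move=> _ [x Ax <-]; have [i _ Fx] := AF x Ax; exists i => //; exists x.
apply: lee_nneseries => [i _ _|i _]; first exact: hausdorff_gauge_ge0.
rewrite {2}/hausdorff_gauge; case: ifPn => [/eqP ->|F0].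
  by rewrite image_set0 hausdorff_gauge0 mule0.
rewrite -poweR_EFin -poweRM ?lee_fin ?(ltW r0) ?eucl_diam_ge0//.
apply: hausdorff_gauge_le => //; apply: eucl_diam_le.
  by rewrite mule_ge0 ?lee_fin ?(ltW r0) ?eucl_diam_ge0.
move=> _ _ [p Fp <-] [q Fq <-]; rewrite (@le_trans _ _ (r * eucl_dist p q)%:E)//.
  by rewrite lee_fin.
by rewrite EFinM lee_pmul2l// eucl_dist_le_diam.
Qed.

(** For s > 0, a cover whose sum of diam^s is below delta^s consists of sets of
    diameter below delta: covers that witness content 0 are automatically fine. *)
Lemma content0_measure0 s A : (0 < s)%R -> hausdorff_content s A = 0 ->
  hausdorff_measure s A = 0.
Proof.
move=> s0 A0; apply/eqP; rewrite eq_le; apply/andP; split; last first.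
  apply: (@le_trans _ _ (hausdorff_premeasure s 1 A)).
    apply: le_ereal_inf_tmp => _ [F _ <-]; apply: nneseries_ge0 => *.
    exact: hausdorff_gauge_ge0.
  by apply: ereal_sup_ubound; exists 1%R => //=; exact: ltr01.
apply: ge_ereal_sup => _ [delta /= delta0 <-].
apply/lee_addgt0Pr => e e0; rewrite add0e.
have eta0 : (0 < Num.min e (delta `^ s))%R by rewrite lt_min e0 powR_gt0.
have : hausdorff_content s A < (Num.min e (delta `^ s))%:E by rewrite A0 lte_fin.
move=> /ereal_inf_lt[_ [F [_ AF] <-] Fe].
have /andP[Fe1 Fe2] : (\sum_(i <oo) hausdorff_gauge s (F i) <= e%:E) &&
    (\sum_(i <oo) hausdorff_gauge s (F i) < (delta `^ s)%:E).
  by rewrite (le_trans (ltW Fe)) ?(lt_le_trans Fe)// lee_fin ge_min lexx ?orbT.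
apply: ge_ereal_inf; exists (\sum_(i <oo) hausdorff_gauge s (F i)) => //.
exists F => //; split => // i; rewrite leNgt; apply/negP => Fi.
have Fi0 : F i != set0.
  apply/eqP => Fi0; move: Fi; apply/negP; rewrite -leNgt.
  by apply: eucl_diam_le => [|p q]; rewrite ?Fi0// lee_fin ltW.
have : (delta `^ s)%:E <= hausdorff_gauge s (F i).
  rewrite /hausdorff_gauge (negbTE Fi0) -poweR_EFin; apply: ge0_le_poweR.
  - exact: ltW.
  - by rewrite lee_fin ltW.
  - exact: ltW.
apply/negP; rewrite -ltNge; apply: le_lt_trans Fe2.
rewrite (@nneseriesD1 _ _ i)//; last by move=> *; exact: hausdorff_gauge_ge0.
by rewrite leeDl// nneseries_ge0// => *; exact: hausdorff_gauge_ge0.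
Qed.

(** The interval is centred at the projection of a point of U with radius
    diam U, hence the factor 2; and diam U <= (diam U)^s as diam U <= 1 and
    s <= 1. *)
Lemma gauge_proj_cover s U : (s <= 1)%R -> eucl_diam U <= 1 ->
  exists I : set R, [/\ measurable I, fst @` U `<=` I
    & lebesgue_measure I <= 2%:E * hausdorff_gauge s U].
Proof.
move=> s1 U1; have [->|U0] := eqVneq U set0.
  by exists set0; split; rewrite ?image_set0// measure0 hausdorff_gauge0 mule0.
have [delta delta0 Ud] : exists2 delta : R, (0 <= delta)%R & eucl_diam U = delta%:E.
  move: (eucl_diam_ge0 U) U1; case: (eucl_diam U) => // r r0 _.
  by exists r.
have /set0P[p Up] := U0.
exists `[(p.1 - delta)%R, (p.1 + delta)%R]%classic; split => //.
  move=> _ [q Uq <-]; rewrite /= in_itv/= -ler_distlC distrC.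
  rewrite (le_trans (eucl_dist_fst _ _))// -lee_fin -Ud.
  exact: eucl_dist_le_diam.
rewrite /hausdorff_gauge (negbTE U0) Ud poweR_EFin -EFinM.
have dd : (delta <= delta `^ s)%R.
  move: delta0; rewrite le_eqVlt => /predU1P[<-|d0]; first exact: powR_ge0.
  by rewrite ger1_powR// d0 -lee_fin -Ud.
rewrite lebesgue_measure_itv/=; case: ifPn => _; last first.
  by rewrite lee_fin mulr_ge0// powR_ge0.
by rewrite -EFinB lee_fin; lra.
Qed.

(** Otherwise [0, 1] would be covered by intervals of total length less than 1. *)
Lemma hausdorff_measure_proj_neq0 s A : (s <= 1)%R ->
  `[0%R, 1%R]%classic `<=` fst @` A -> hausdorff_measure s A <> 0.
Proof.
move=> s1 A01 A0.
(* 1/2 compensates the factor 2 lost in [gauge_proj_cover] *)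
have : hausdorff_premeasure s 1 A < (2^-1)%:E.
  apply: (@le_lt_trans _ _ (hausdorff_measure s A)).
    by apply: ereal_sup_ubound; exists 1%R => //=; exact: ltr01.
  by rewrite A0 lte_fin.
move=> /ereal_inf_lt[_ [F [AF F1] <-] Fe].
have /choice[I /all_and3[mI FI lI]] := fun i => gauge_proj_cover s1 (F1 i).
have : lebesgue_measure `[0%R, 1%R]%classic <=
    \sum_(i <oo) lebesgue_measure (I i) :> \bar R.
  apply: measure_sigma_subadditive => // x /A01[p Ap <-].
  by have [i _ Fip] := AF _ Ap; exists i => //; apply: FI; exists p.
apply/negP; rewrite -ltNge lebesgue_measure_itv/= lte_fin ltr01 oppr0 adde0.
apply: (@le_lt_trans _ _ (2%:E * \sum_(i <oo) hausdorff_gauge s (F i))).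
  rewrite -nneseriesZl; last by move=> *; exact: hausdorff_gauge_ge0.
  exact: lee_nneseries.
by rewrite muleC -lte_pdivlMr// mul1e.
Qed.

End hausdorff_content.

(** * Self-similarity and the content of the graph *)

Section sheared_graph.
Context {R : realType}.
Implicit Types (s : R) (k m d n : nat).

(** Image of the graph above [0, 1/m] under the k-th power of the shear
    (u, v) |-> (u, u + v). *)
Definition sheared_graph k m : set (R * R) :=
  [set (x, k%:R * x + pierce_error_sum x) | x in `[0, m%:R^-1]].

(** As |kx + E(x)| <= (k+2)x, the set lies in a box of width 1/m and height
    2(k+2)/m; its diameter is at most the sum of the two. *)
Lemma content_sheared_graph_bound s k m : 0 <= s -> (0 < m)%N ->
  (hausdorff_content s (sheared_graph k m) <=
   ((2 * k + 5)%:R `^ s * m%:R^-1 `^ s)%:E)%E.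
Proof.
move=> s0 m0; apply: (le_trans (content_le_gauge _ _)).
rewrite -powRM// -poweR_EFin; apply: hausdorff_gauge_le => //.
have mi1 : m%:R^-1 <= 1 :> R by rewrite invf_le1 ?ltr0n// ler1n.
have bnd (x : R) : 0 <= x <= m%:R^-1 ->
    `|k%:R * x + pierce_error_sum x| <= (k + 2)%:R * m%:R^-1.
  move=> /andP[x0 xm]; apply: (le_trans (ler_normD _ _)).
  apply: (@le_trans _ _ (k%:R * x + 2 * x)).
    rewrite lerD//; first by rewrite normrM !ger0_norm.
    by apply: pierce_error_sum_le; rewrite x0 (le_trans xm).
  by rewrite -mulrDl -natrD ler_wpM2l.
apply: eucl_diam_le; first by rewrite lee_fin mulr_ge0.
move=> _ _ [x + <-] [y + <-] => /=; rewrite !in_itv/= => xm ym.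
rewrite lee_fin; apply: (le_trans (eucl_dist_le_sum _ _)) => /=.
have -> : (2 * k + 5)%:R * m%:R^-1 =
    m%:R^-1 + ((k + 2)%:R * m%:R^-1 + (k + 2)%:R * m%:R^-1) :> R.
  by rewrite natrD natrM natrD; ring.
apply: lerD.
  by move/andP: xm => [? ?]; move/andP: ym => [? ?]; rewrite ler_norml; lra.
by apply: (le_trans (ler_normB _ _)); apply: lerD; exact: bnd.
Qed.

(** The inverse branch of the Pierce map for the digit d, lifted to sheared
    graphs: it maps (y, (k+1)y + E(y)) to (x, kx + E(x)) for x = (1 - y)/d. *)
Definition pierce_branch k d (p : R * R) : R * R :=
  (d%:R^-1 - d%:R^-1 * p.1, k%:R * d%:R^-1 - d%:R^-1 * p.2).

Lemma eucl_dist_pierce_branch k d p q :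
  eucl_dist (pierce_branch k d p) (pierce_branch k d q) = d%:R^-1 * eucl_dist p q.
Proof.
rewrite /eucl_dist /= -[X in X * Num.sqrt _]ger0_norm// -sqrtr_sqr.
by rewrite -sqrtrM ?sqr_ge0//; congr Num.sqrt; ring.
Qed.

Lemma sheared_graph_cover k m : (0 < m)%N ->
  sheared_graph k m `<=` \bigcup_i
    (if i is j.+1 then pierce_branch k (m + j) @` sheared_graph k.+1 (m + j).+1
     else [set 0]).
Proof.
move=> m0 _ [x + <-]; rewrite /= in_itv/= => /andP[x0 xm].
have m1 : m%:R^-1 <= 1 :> R by rewrite invf_le1 ?ltr0n// ler1n.
move: x0; rewrite le_eqVlt => /predU1P[<-|x0].
  exists 0%N => //=; rewrite mulr0 add0r.
  have := @pierce_error_sum_le R 0; rewrite lexx ler01 => /(_ isT).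
  by rewrite mulr0 normr_le0 => /eqP ->.
have x01 : 0 < x <= 1 by rewrite x0 (le_trans xm).
have [d [d0 dx xd]] := pierce_d1P x01.
have /andP[T0 Td] := pierce_T_itv d0 xd dx.
have md : (m <= d)%N.
  case/andP: xd => xd _; have := lt_le_trans xd xm.
  by rewrite ltf_pV2 ?posrE ?ltr0n// ltr_nat ltnS.
exists (d - m).+1 => //=; rewrite subnKC//.
exists (pierce_T x, k.+1%:R * pierce_T x + pierce_error_sum (pierce_T x)).
  by exists (pierce_T x) => //; rewrite /= in_itv/= T0 ltW.
rewrite /pierce_branch/= (pierce_error_sumE x01 d0 xd dx).
have dn0 : d%:R != 0 :> R by rewrite pnatr_eq0 -lt0n.
rewrite (pierce_TE (lt0r_neq0 x0) dx); set E := pierce_error_sum _.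
by congr (_, _); rewrite -?natr1; field.
Qed.

(** With a = 1/(d(d+1)), write a^s = a * a^(s-1).  The factors a telescope to at
    most 1/m, and a <= 1/(2m) as d >= m and d+1 >= 2, so that
    a^(s-1) <= 2^(1-s) m^(1-s). *)
Lemma sum_pow_consecutive_le s m N : 1 < s -> (0 < m)%N ->
  \sum_(0 <= i < N) ((m + i)%:R^-1 `^ s * (m + i).+1%:R^-1 `^ s) <=
  2^-1 `^ (s - 1) * m%:R^-1 `^ s :> R.
Proof.
move=> s1 m0; have s0 : 0 < s by lra.
have m0' : 0 < m%:R :> R by rewrite ltr0n.
pose c : R := 2^-1 `^ (s - 1) * m%:R^-1 `^ (s - 1).
apply: (@le_trans _ _ (\sum_(0 <= i < N) c * - ((m + i.+1)%:R^-1 - (m + i)%:R^-1))).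
  apply: ler_sum => i _.
  have d0 : 0 < (m + i)%:R :> R by rewrite ltr0n addn_gt0 m0.
  have d1 : 0 < (m + i).+1%:R :> R by rewrite ltr0n.
  rewrite -powRM ?invr_ge0// -mulr_powRB1 ?mulr_ge0 ?invr_ge0//.
  have -> : - ((m + i.+1)%:R^-1 - (m + i)%:R^-1) = (m + i)%:R^-1 * (m + i).+1%:R^-1 :> R.
    rewrite addnS; move: d1; rewrite -natr1; move: (_%:R) d0 => d d0 d1.
    by field; rewrite !gt_eqF.
  rewrite mulrC ler_pM2r ?mulr_gt0 ?invr_gt0// /c -powRM ?invr_ge0//.
  rewrite ge0_ler_powR ?nnegrE ?mulr_ge0 ?invr_ge0//; first by lra.
  rewrite mulrC ler_pM ?invr_ge0// lef_pV2 ?posrE// ?ler_nat//.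
    by rewrite ltnS addn_gt0 m0.
  by rewrite leq_addr.
rewrite -mulr_sumr sumrN telescope_sumr// addn0 opprB.
rewrite -[m%:R^-1 `^ s]mulr_powRB1 ?invr_ge0 ?(ltW m0')// [leRHS]mulrCA mulrC.
by rewrite ler_wpM2r ?mulr_ge0 ?powR_ge0// gerBl invr_ge0.
Qed.

(** Each of the n steps replaces (k, m) by (k+1, d+1) for all d >= m; the sum over
    d of d^(-s) (d+1)^(-s) returns the dependence m^(-s) that was assumed, with
    the gain 2^(1-s). *)
Lemma content_sheared_graph_iter s n k m : 1 < s -> (0 < m)%N ->
  (hausdorff_content s (sheared_graph k m) <=
   ((2^-1 `^ (s - 1)) ^+ n * (2 * (k + n) + 5)%:R `^ s * m%:R^-1 `^ s)%:E)%E.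
Proof.
move=> s1; have s0 : 0 < s by lra.
elim: n k m => [|n IH] k m m0.
  by rewrite expr0 mul1r addn0; apply: content_sheared_graph_bound => //; exact: ltW.
set t := 2^-1 `^ (s - 1); set K := (2 * (k + n.+1) + 5)%:R `^ s.
have tK0 : 0 <= t ^+ n * K by rewrite mulr_ge0 ?exprn_ge0 ?powR_ge0.
apply: (le_trans (content_bigcup s (@sheared_graph_cover k m m0))).
rewrite nneseries_recl//; last by move=> *; exact: content_ge0.
have -> : hausdorff_content s [set (0 : R * R)] = 0%E.
  apply/eqP; rewrite eq_le content_ge0 andbT (le_trans (content_le_gauge _ _))//.
  rewrite -(@poweR0r _ s) ?gt_eqF//; apply: hausdorff_gauge_le; first exact: ltW.
  apply: eucl_diam_le => // p q /= -> ->.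
  by rewrite /eucl_dist !subrr expr0n addr0 sqrtr0.
rewrite add0e -nneseries_addn; last by move=> *; exact: content_ge0.
apply: lime_le; first by apply: is_cvg_nneseries => *; exact: content_ge0.
apply: nearW => N.
apply: (@le_trans _ _ (\sum_(0 <= i < N)
   (t ^+ n * K * ((m + i)%:R^-1 `^ s * (m + i).+1%:R^-1 `^ s))%:E)%E).
  apply: lee_sum => i _; rewrite addn1.
  have d0 : 0 < (m + i)%:R :> R by rewrite ltr0n addn_gt0 m0.
  apply: (le_trans (@content_lipschitz _ s (m + i)%:R^-1 _ _ _ _ _)).
  - exact: ltW.
  - by rewrite invr_gt0.
  - by move=> p q; rewrite eucl_dist_pierce_branch.
  rewrite [X in (_ <= X%:E)%E]mulrCA EFinM.
  rewrite lee_pmul2l ?lte_fin ?powR_gt0 ?invr_gt0//.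
  by have := IH k.+1 (m + i).+1 isT; rewrite addSnnS.
rewrite sumEFin lee_fin -mulr_sumr exprSr [t ^+ n * t * K]mulrAC -[leRHS]mulrA.
by rewrite ler_wpM2l//; exact: sum_pow_consecutive_le.
Qed.

(** By Bernoulli's inequality (1+h)^n >= 1 + nh. *)
Lemma affine_le_geometric (h : R) n : 0 < h ->
  (2 * n + 5)%:R <= (5 + 2 / h) * (1 + h) ^+ n.
Proof.
move=> h0; have nh : 1 + n%:R * h <= (1 + h) ^+ n.
  elim: n => [|n IH]; first by rewrite expr0 mul0r addr0.
  rewrite exprS; apply: le_trans (_ : (1 + h) * (1 + n%:R * h) <= _).
    have : 0 <= n%:R :> R by []. rewrite -natr1; nra.
  by rewrite ler_pM2l//; lra.
have K0 : 0 < 5 + 2 / h by rewrite addr_gt0// divr_gt0.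
apply: (@le_trans _ _ ((5 + 2 / h) * (1 + n%:R * h))); last by rewrite ler_pM2l.
have -> : (5 + 2 / h) * (1 + n%:R * h) = 5 + 2 / h + 5 * (n%:R * h) + 2 * n%:R.
  by field; rewrite gt_eqF.
rewrite natrD natrM; have : 0 <= 2 / h by rewrite divr_ge0// ltW.
have : 0 <= n%:R * h by rewrite mulr_ge0// ltW.
by lra.
Qed.

(** The bound of [content_sheared_graph_iter] tends to 0: comparing 2n+5 with
    powers of rho = 2^((s-1)/(2s)) leaves a geometric sequence of ratio
    u = rho^s 2^(1-s) = 2^(-(s-1)/2) < 1. *)
Lemma content_graph0 s : 1 < s ->
  hausdorff_content s (@pierce_error_sum_graph R) = 0%E.
Proof.
move=> s1; have s0 : 0 < s by lra.
apply/eqP; rewrite eq_le content_ge0 andbT.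
have half_powR y : 2^-1 `^ y = 2 `^ (- y) :> R.
  by rewrite -powR_inv1// -powRrM mulN1r.
pose rho : R := 2 `^ ((s - 1) / (2 * s)).
have rho1 : 1 < rho.
  rewrite /rho -[X in X < _](powRr0 2) /powR !pnatr_eq0/= ltr_expR mul0r.
  by rewrite mulr_gt0 ?divr_gt0 ?ln_gt0 ?mulr_gt0 ?subr_gt0// ltr1n.
pose K := (5 + 2 / (rho - 1)) `^ s; pose u : R := 2^-1 `^ ((s - 1) / 2).
have K0 : 0 <= K by exact: powR_ge0.
have rsu : rho `^ s * 2^-1 `^ (s - 1) = u.
  rewrite /rho /u !half_powR -powRrM -powRD; last by rewrite pnatr_eq0 implybT.
  by congr (_ `^ _); field; rewrite gt_eqF.
have u0 : 0 < u by rewrite powR_gt0// invr_gt0.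
have u1 : u < 1.
  rewrite /u half_powR -[X in _ < X](powRr0 2) /powR !pnatr_eq0/= ltr_expR mul0r.
  by rewrite pmulr_llt0 ?ln_gt0 ?ltr1n//; lra.
have graphE : @pierce_error_sum_graph R = sheared_graph 0 1.
  rewrite /sheared_graph invr1; apply/seteqP; split => _ [x x01 <-]; exists x => //.
    by rewrite mul0r add0r.
  by rewrite mul0r add0r.
have bound n : (hausdorff_content s (@pierce_error_sum_graph R) <= (K * u ^+ n)%:E)%E.
  rewrite graphE; apply: (le_trans (@content_sheared_graph_iter s n 0 1 s1 isT)).
  rewrite lee_fin add0n invr1 powR1 mulr1 -rsu exprMn mulrA mulrC.
  rewrite ler_pM2r ?exprn_gt0 ?powR_gt0//.
  have rn : (rho `^ s) ^+ n = (rho ^+ n) `^ s.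
    rewrite -powR_mulrn ?powR_ge0// -[rho ^+ n]powR_mulrn ?powR_ge0//.
    by rewrite -[RHS]powRrM mulrC powRrM.
  rewrite rn -powRM ?exprn_ge0//; first last.
  - exact: powR_ge0.
  - by rewrite addr_ge0// divr_ge0// subr_ge0 ltW.
  have r1 : 0 < rho - 1 by rewrite subr_gt0.
  have := affine_le_geometric n r1; rewrite [1 + _]addrC subrK => le1.
  by rewrite ge0_ler_powR ?nnegrE// ?(ltW s0)// (le_trans _ le1).
apply/lee_addgt0Pr => e e0; rewrite add0e.
have : (fun n => K * u ^+ n) @ \oo --> (0 : R).
  rewrite -[X in _ --> X](mulr0 K); apply: cvgMr; apply: cvg_expr.
  by rewrite gtr0_norm.
move=> /cvgrPdist_lt /(_ e e0)[N _ /(_ N (leqnn N))/=].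
rewrite sub0r normrN => /ltW le1; apply: (le_trans (bound N)).
by rewrite lee_fin (le_trans (ler_norm _)).
Qed.

End sheared_graph.

Theorem theorem4p1 (R : realType) :
  hausdorff_dim (@pierce_error_sum_graph R) = 1%E.
Proof.
apply/eqP; rewrite eq_le; apply/andP; split.
  apply/lee_addgt0Pr => e e0; apply: ereal_inf_lbound; exists (1 + e) => //.
  have s1 : 1 < 1 + e by rewrite ltrDl.
  split; first by rewrite (le_trans ler01)// ltW.
  by apply: content0_measure0; [exact: lt_trans s1|exact: content_graph0].
apply: le_ereal_inf_tmp => _ [s [s0 Hs] <-]; rewrite lee_fin leNgt.
apply/negP => s1; apply: (hausdorff_measure_proj_neq0 (ltW s1) _ Hs).
by move=> x x01; exists (x, pierce_error_sum x) => //; exists x.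
Qed.
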